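(* Let $\mathfrak{T}=(T,\le)$ be a linear order, $\lhd\in\{\le,<\}$, $\langle a,b\rangle\in\mathrm{int}(\mathfrak{T})$, and let $\varphi$ be an $\mathcal{HS}^\Box_{\mathit{horn}}$-formula. Then $\varphi$ is $\langle a,b\rangle$-satisfiable in $\mathfrak{T}(\lhd)$ if and only if $\bot@\langle x,y\rangle\notin\mathsf{cl}^*(\mathfrak{V}_\varphi)$ for every $\langle x,y\rangle\in\mathrm{int}(\mathfrak{T})$. Furthermore, if some model $\mathfrak{M}$ based on $\mathfrak{T}(\lhd)$ satisfies $\mathfrak{M},\langle a,b\rangle\models\varphi$, then $\mathfrak{K}_\varphi^{\langle a,b\rangle},\langle a,b\rangle\models\varphi$ and, for every $\langle x,y\rangle\in\mathrm{int}(\mathfrak{T})$ and every propositional variable $p$, $\mathfrak{K}_\varphi^{\langle a,b\rangle},\langle x,y\rangle\models p$ implies $\mathfrak{M},\langle x,y\rangle\models p$.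
   Context: Let $\mathfrak{T}=(T,\le)$ be a linear order. An interval is a pair $\langle x,y\rangle$ with $x,y\in T$, $x\le y$ (punctual intervals $\langle x,x\rangle$ allowed); $\mathrm{int}(\mathfrak{T})$ is the set of intervals. Under the irreflexive semantics the twelve interval relations are: $\langle x_1,y_1\rangle \mathsf{A}\langle x_2,y_2\rangle$ iff $y_1=x_2$ and $x_2<y_2$; $\mathsf{B}$: $x_1=x_2$, $y_2<y_1$; $\mathsf{E}$: $x_1<x_2$, $y_1=y_2$; $\mathsf{D}$: $x_1<x_2$, $y_2<y_1$; $\mathsf{L}$: $y_1<x_2$; $\mathsf{O}$: $x_1<x_2<y_1<y_2$; $\bar{\mathsf{A}}$: $y_2=x_1$, $x_2<y_2$; $\bar{\mathsf{B}}$: $x_1=x_2$, $y_1<y_2$; $\bar{\mathsf{E}}$: $x_2<x_1$, $y_1=y_2$; $\bar{\mathsf{D}}$: $x_2<x_1$, $y_1<y_2$; $\bar{\mathsf{L}}$: $y_2<x_1$; $\bar{\mathsf{O}}$: $x_2<x_1<y_2<y_1$. The reflexive semantics replaces every $<$ in these definitions by $\le$. $\mathfrak{T}(<)$ and $\mathfrak{T}(\le)$ denote $\mathfrak{T}$ with the irreflexive, resp. reflexive, semantics. Literals: $\lambda::=\top\mid\bot\mid p\mid\langle\mathsf{R}\rangle\lambda\mid[\mathsf{R}]\lambda$ with $p$ a propositional variable and $\mathsf{R}$ an interval relation. $\mathcal{HS}_{\mathit{horn}}$-formulas: $\varphi::=\lambda\mid[\mathsf{U}](\lambda_1\wedge\dots\wedge\lambda_k\to\lambda)\mid\varphi_1\wedge\varphi_2$;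 conjuncts of the form $\lambda$ are initial conditions, those of the other form clauses. $\mathcal{HS}^\Box_{\mathit{horn}}$ is the set of $\mathcal{HS}_{\mathit{horn}}$-formulas without diamonds $\langle\mathsf{R}\rangle$. A model based on $\mathfrak{T}(\lhd)$ is a valuation $\nu$ of variables into subsets of $\mathrm{int}(\mathfrak{T})$; truth: $\top$ always true, $\bot$ never, $p$ true at $\langle x,y\rangle$ iff $\langle x,y\rangle\in\nu(p)$, $\langle\mathsf{R}\rangle\lambda$ (resp. $[\mathsf{R}]\lambda$) true iff $\lambda$ true at some (resp. every) $\mathsf{R}$-successor, $[\mathsf{U}](\lambda_1\wedge\dots\wedge\lambda_k\to\lambda)$ true iff at every interval where all $\lambda_i$ hold, $\lambda$ holds; $\wedge$ as usual. $\varphi$ is $\langle a,b\rangle$-satisfiable in $\mathfrak{T}(\lhd)$ if some model based on $\mathfrak{T}(\lhd)$ makes $\varphi$ true at $\langle a,b\rangle$. Closure: let $\mathfrak{V}_\varphi=\{\lambda@\langle a,b\rangle\mid\lambda\text{ an initial condition of }\varphi\}\cup\{\top@\langle x,y\rangle\mid\langle x,y\rangle\in\mathrm{int}(\mathfrak{T})\}$ (a set of pairs literal@interval). For a set $\mathfrak{V}$ of such pairs, $\mathsf{cl}(\mathfrak{V})$ is obtained by adding, in one round (non-recursively), for every interval relation $\mathsf{R}$ of $\mathfrak{T}(\lhd)$: (cl1) if $[\mathsf{R}]\lambda@\langle x,y\rangle\in\mathfrak{V}$, all $\lambda@\langle x',y'\rangle$ with $\langle x,y\rangle\mathsf{R}\langle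 x',y'\rangle$; (cl2) if $[\mathsf{R}]\lambda$ occurs in $\varphi$ and $\lambda@\langle x',y'\rangle\in\mathfrak{V}$ for all $\langle x',y'\rangle$ with $\langle x,y\rangle\mathsf{R}\langle x',y'\rangle$, then $[\mathsf{R}]\lambda@\langle x,y\rangle$; (cl3) if $[\mathsf{U}](\lambda_1\wedge\dots\wedge\lambda_k\to\lambda)$ is a clause of $\varphi$ and $\lambda_i@\langle x,y\rangle\in\mathfrak{V}$ for all $i$, then $\lambda@\langle x,y\rangle$. Set $\mathsf{cl}^0(\mathfrak{V}_\varphi)=\mathfrak{V}_\varphi$, $\mathsf{cl}^{\alpha+1}=\mathsf{cl}(\mathsf{cl}^\alpha)$, $\mathsf{cl}^\beta=\bigcup_{\alpha<\beta}\mathsf{cl}^\alpha$ for limit $\beta$, and $\mathsf{cl}^*(\mathfrak{V}_\varphi)=\bigcup_\gamma\mathsf{cl}^\gamma(\mathfrak{V}_\varphi)$ over all ordinals. $\mathfrak{K}_\varphi^{\langle a,b\rangle}$ is the model based on $\mathfrak{T}(\lhd)$ with $\nu(p)=\{\langle x,y\rangle\mid p@\langle x,y\rangle\in\mathsf{cl}^*(\mathfrak{V}_\varphi)\}$. *)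

(* Defs.v *)
From Stdlib Require List.
From mathcomp Require Import all_boot all_order.
From mathcomp Require Import boolp classical_sets.

Set Implicit Arguments.
Unset Strict Implicit.
Unset Printing Implicit Defensive.

Import Order.TTheory.
Local Open Scope order_scope.
Local Open Scope classical_set_scope.

Record hs_interval d (T : orderType d) : Type :=
  HSInterval { lo : T; hi : T; lo_le_hi : lo <= hi }.

Inductive semantics : Set := Irreflexive | Reflexive.

Inductive hs_rel : Set :=
  | RA | RB | RE | RD | RL | RO
  | RAbar | RBbar | REbar | RDbar | RLbar | RObar.

Definition lhd (s : semantics) d (T : orderType d) (x y : T) : bool :=
  match s with
  | Irreflexive => x < y
  | Reflexive => x <= y
  end.

(* All twelve relations are spelled out, because a barred relation need not be
   the converse of the unbarred one: with the irreflexive semantics, RA asks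
   its second argument to be non-punctual, and so does RAbar. *)
Definition hs_succ (s : semantics) d (T : orderType d) (r : hs_rel)
    (i j : hs_interval T) : bool :=
  let x1 := lo i in let y1 := hi i in
  let x2 := lo j in let y2 := hi j in
  match r with
  | RA    => (y1 == x2) && lhd s x2 y2
  | RB    => (x1 == x2) && lhd s y2 y1
  | RE    => lhd s x1 x2 && (y1 == y2)
  | RD    => lhd s x1 x2 && lhd s y2 y1
  | RL    => lhd s y1 x2
  | RO    => [&& lhd s x1 x2, lhd s x2 y1 & lhd s y1 y2]
  | RAbar => (y2 == x1) && lhd s x2 y2
  | RBbar => (x1 == x2) && lhd s y1 y2
  | REbar => lhd s x2 x1 && (y1 == y2)
  | RDbar => lhd s x2 x1 && lhd s y1 y2
  | RLbar => lhd s y2 x1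
  | RObar => [&& lhd s x2 x1, lhd s x1 y2 & lhd s y2 y1]
  end.

Inductive literal (P : Type) : Type :=
  | Top
  | Bot
  | PVar of P
  | Dia of hs_rel & literal P
  | Box of hs_rel & literal P.
Arguments Top {P}.
Arguments Bot {P}.

(* [Clause ls l] is [U](/\ ls -> l); the empty conjunction is allowed. *)
Inductive horn (P : Type) : Type :=
  | Init of literal P
  | Clause of seq (literal P) & literal P
  | And of horn P & horn P.

Fixpoint lit_box_only (P : Type) (l : literal P) : bool :=
  match l with
  | Dia _ _ => false
  | Box _ l' => lit_box_only l'
  | _ => true
  end.

Fixpoint horn_box (P : Type) (phi : horn P) : bool :=
  match phi with
  | Init l => lit_box_only l
  | Clause ls l => all (@lit_box_only P) ls && lit_box_only l
  | And phi1 phi2 => horn_box phi1 && horn_box phi2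
  end.

Fixpoint initial_condition (P : Type) (phi : horn P) (l : literal P) : Prop :=
  match phi with
  | Init l' => l = l'
  | Clause _ _ => False
  | And phi1 phi2 => initial_condition phi1 l \/ initial_condition phi2 l
  end.

Fixpoint has_clause (P : Type) (phi : horn P) (ls : seq (literal P))
    (l : literal P) : Prop :=
  match phi with
  | Init _ => False
  | Clause ls' l' => ls = ls' /\ l = l'
  | And phi1 phi2 => has_clause phi1 ls l \/ has_clause phi2 ls l
  end.

Fixpoint occurs_in_literal (P : Type) (m l : literal P) : Prop :=
  m = l \/
  match l with
  | Dia _ l' | Box _ l' => occurs_in_literal m l'
  | _ => False
  end.

Fixpoint occurs (P : Type) (m : literal P) (phi : horn P) : Prop :=
  match phi with
  | Init l => occurs_in_literal m l
  | Clause ls l =>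
      (exists2 l', List.In l' ls & occurs_in_literal m l') \/
      occurs_in_literal m l
  | And phi1 phi2 => occurs m phi1 \/ occurs m phi2
  end.

Definition model (P : Type) d (T : orderType d) : Type :=
  P -> set (hs_interval T).

Section Truth.
Variables (P : Type) (d : Order.disp_t) (T : orderType d) (s : semantics).

Fixpoint lit_true (M : model P T) (i : hs_interval T) (l : literal P) : Prop :=
  match l with
  | Top => True
  | Bot => False
  | PVar p => M p i
  | Dia r l' => exists2 j, hs_succ s r i j & lit_true M j l'
  | Box r l' => forall j, hs_succ s r i j -> lit_true M j l'
  end.

Fixpoint horn_true (M : model P T) (i : hs_interval T) (phi : horn P) : Prop :=
  match phi with
  | Init l => lit_true M i l
  | Clause ls l =>
      forall j, (forall l', List.In l' ls -> lit_true M j l') -> lit_true M j l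
  | And phi1 phi2 => horn_true M i phi1 /\ horn_true M i phi2
  end.

Definition satisfiable_at (i : hs_interval T) (phi : horn P) : Prop :=
  exists M : model P T, horn_true M i phi.

End Truth.

(* Ordinals are represented by the elements [w] of well-ordered types [W], [w]
   standing for the order type of its set of strict predecessors. *)
Section TransfiniteIteration.
Variables (o : Order.disp_t) (W : orderType o).

Definition is_least (w : W) : Prop := forall u, w <= u.

Definition is_successor (w u : W) : Prop :=
  u < w /\ forall v, u < v -> w <= v.

Definition is_limit (w : W) : Prop :=
  ~ is_least w /\ ~ exists u, is_successor w u.

Variable W_wf : well_founded (fun u w : W => u < w).
Variables (X : Type) (F : set X -> set X) (A : set X).

Definition iterate_body (w : W) (rec : forall u : W, u < w -> set X) : set X :=
  [set x |
    [\/ is_least w /\ A x,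
        exists u (uw : u < w), is_successor w u /\ F (rec u uw) x
      | is_limit w /\ exists u (uw : u < w), rec u uw x]].

Definition iterate : W -> set X := Fix W_wf (fun _ => set X) iterate_body.

Lemma iterateE (w : W) : iterate w = iterate_body (fun u (_ : u < w) => iterate u).
Proof.
rewrite {1}/iterate Fix_eq // => v f g fg.
by congr iterate_body; apply/functional_extensionality_dep => u;
  apply/functional_extensionality_dep => uv; exact: fg.
Qed.

Lemma iterate_least (w : W) : is_least w -> iterate w = A.
Proof.
move=> w0; rewrite iterateE; apply/seteqP; split=> x /=.
  case=> [[]//|[u [uw _]]|[[]//]].
  by move: uw; rewrite ltNge w0.
by move=> Ax; constructor 1.
Qed.

Lemma iterate_successor (w u : W) :
  is_successor w u -> iterate w = F (iterate u).
Proof.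
move=> wu; have [uw uP] := wu; rewrite iterateE; apply/seteqP; split=> x /=.
  case=> [[w0]|[v [vw [[_ vP] Fx]]]|[[_ []]]]; last by exists u.
  - by move: uw; rewrite ltNge w0.
  - suff <- : v = u by [].
    apply/le_anti/andP; split; rewrite leNgt; apply/negP.
      by move=> /uP; rewrite leNgt vw.
    by move=> /vP; rewrite leNgt uw.
by move=> Fx; constructor 2; exists u, uw.
Qed.

Lemma iterate_limit (w : W) :
  is_limit w -> iterate w = \bigcup_(u in [set u | u < w]) iterate u.
Proof.
move=> wl; have [wN0 wNS] := wl; rewrite iterateE; apply/seteqP; split=> x /=.
  case=> [[]//|[u [_ [wu _]]]|[_ [u [uw Hx]]]]; last by exists u.
  by case: wNS; exists u.
by move=> [u uw Hx]; constructor 3; split=> //; exists u, uw.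
Qed.

End TransfiniteIteration.

Section Closure.
Variables (P : Type) (d : Order.disp_t) (T : orderType d) (s : semantics).
Variables (ab : hs_interval T) (phi : horn P).

(* The pair [(l, i)] is l@i. *)
Definition V_init : set (literal P * hs_interval T) :=
  [set li | initial_condition phi li.1 /\ li.2 = ab] `|` [set li | li.1 = Top].

Definition cl (V : set (literal P * hs_interval T)) :
    set (literal P * hs_interval T) :=
  V
  `|` [set li | exists r i, V (Box r li.1, i) /\ hs_succ s r i li.2]
  `|` [set li | exists r l, [/\ li.1 = Box r l, occurs (Box r l) phi &
                               forall j, hs_succ s r li.2 j -> V (l, j)]]
  `|` [set li | exists ls, has_clause phi ls li.1 /\
                           forall l, List.In l ls -> V (l, li.2)].

Definition cl_star : set (literal P * hs_interval T) :=
  [set li | exists (o : Order.disp_t) (W : orderType o)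
                   (W_wf : well_founded (fun u w : W => u < w)) (w : W),
              iterate W_wf cl V_init w li].

Definition canonical_model : model P T :=
  fun p => [set i | cl_star (PVar p, i)].

End Closure.

(* Main.v *)
(** The transfinite iteration of an inflationary operator [F] from [A] runs
    through a tower of sets that is well-ordered by inclusion.  This tower,
    taken itself as the index order, iterates to its own elements, and its
    largest element is closed under [F]: hence [cl_star] is the least
    [cl]-closed set containing [V_init].  The literals true in a model of [phi]
    form such a closed set, which gives soundness and minimality of the
    canonical model; conversely, without diamonds, the closure rules are exactly
    the truth conditions of the literals of [phi] in the canonical model, as
    long as [Bot] is not derived. *)
From HB Require Import structures.
Require Import Defs.
From mathcomp Require Import all_boot all_order.
From mathcomp Require Import boolp classical_sets.

Set Implicit Arguments.
Unset Strict Implicit.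
Unset Printing Implicit Defensive.

Import Order.TTheory.

Local Open Scope classical_set_scope.

(** * The tower of an inflationary operator, in the style of Bourbaki and Witt *)

Section Tower.
Variables (X : Type) (F : set X -> set X) (A : set X).
Hypothesis F_ext : forall V, V `<=` F V.

(** The summand [A] in [tower_sup] makes the empty family produce the bottom stage. *)
Inductive tower : set X -> Prop :=
  | tower_step V : tower V -> tower (F V)
  | tower_sup (S : set (set X)) :
      (forall V, S V -> tower V) -> tower (A `|` \bigcup_(V in S) V).

Lemma tower_base V : tower V -> A `<=` V.
Proof.
elim=> [U _ AU|S _ _]; last exact: subsetUl.
exact: subset_trans AU (@F_ext U).
Qed.

Lemma sup_sub (S : set (set X)) V :
  A `<=` V -> (forall U, S U -> U `<=` V) -> A `|` \bigcup_(U in S) U `<=` V.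
Proof. by move=> AV SV; rewrite subUset; split=> // x [U /SV]; apply. Qed.

Lemma sub_sup (S : set (set X)) V :
  S V -> V `<=` A `|` \bigcup_(U in S) U.
Proof. by move=> SV x Vx; right; exists V. Qed.

Lemma sup_cases (S : set (set X)) V : A `<=` V ->
  (A `|` \bigcup_(U in S) U `<=` V) \/ exists2 U, S U & ~ (U `<=` V).
Proof.
move=> AV; case: (pselect (exists2 U, S U & ~ (U `<=` V))) => [|noU]; first by right.
left; apply: sup_sub => // U SU.
by case: (pselect (U `<=` V)) => // UV; case: noU; exists U.
Qed.

(** As [F] is only inflationary, comparability cannot come from monotonicity. The assumption on [C]
    says that [F] never jumps over [C] from strictly below; this settles the step case of the
    induction on [V]. *)
Lemma tower_gap_of_extreme C :
    tower C -> (forall V, tower V -> V `<=` C -> V <> C -> F V `<=` C) ->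
  forall V, tower V -> V `<=` C \/ F C `<=` V.
Proof.
move=> tC extC V; elim=> {V} [V tV [VC|CV]|S _ IH].
- case: (pselect (V = C)) => [->|nVC]; first by right.
  by left; exact: extC.
- by right; exact: subset_trans CV (@F_ext V).
- case: (sup_cases S (tower_base tC)) => [|[U SU UC]]; first by left.
  case: (IH _ SU) => // CU; right.
  exact: subset_trans CU (sub_sup SU).
Qed.

(** Induction on [C]. For [F C], the gap at [C] forces [V] into [C]. For a supremum, some member [U]
    is not inside [V], and the gap at [U] forces [V] strictly inside [U]. *)
Lemma tower_extreme C : tower C ->
  forall V, tower V -> V `<=` C -> V <> C -> F V `<=` C.
Proof.
elim=> {C} [C tC IH V tV VC nVC|S tS IH V tV VS nVS].
  case: (tower_gap_of_extreme tC IH tV) => [VC'|CV]; last first.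
    by case: nVC; apply/seteqP.
  case: (pselect (V = C)) => [->//|nVC'].
  exact: subset_trans (IH _ tV VC' nVC') (@F_ext C).
case: (sup_cases S (tower_base tV)) => [SV|[U SU UV]].
  by case: nVS; apply/seteqP.
case: (tower_gap_of_extreme (tS _ SU) (IH _ SU) tV) => [VU|UV'].
  apply: subset_trans (sub_sup SU); apply: IH => // VUE.
  by apply: UV; rewrite VUE.
by case: UV; exact: subset_trans (@F_ext U) UV'.
Qed.

Lemma tower_gap C V : tower C -> tower V -> V `<=` C \/ F C `<=` V.
Proof. by move=> tC; exact: tower_gap_of_extreme (tower_extreme tC) V. Qed.

Lemma tower_fixed_max C V : tower C -> F C = C -> tower V -> V `<=` C.
Proof.
move=> tC FC; elim=> {V} [V tV VC|S _ IH].
  case: (pselect (V = C)) => [->|nVC]; first by rewrite FC.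
  exact: tower_extreme.
by apply: sup_sub => //; exact: tower_base.
Qed.

(** * The tower as a well-ordered index type *)

Definition tower_type : Type := {V : set X | tower V}.

HB.instance Definition _ := gen_eqMixin tower_type.
HB.instance Definition _ := gen_choiceMixin tower_type.

Implicit Types v w : tower_type.

Lemma tower_type_inj v w : sval v = sval w -> v = w.
Proof. by case: v w => [V tV] [W tW] /=; exact: eq_exist. Qed.

Definition tower_le v w : bool := `[< sval v `<=` sval w >].
Lemma tower_le_refl : reflexive tower_le.
Proof. by move=> v; apply/asboolP. Qed.

Lemma tower_le_anti : antisymmetric tower_le.
Proof.
move=> v w /andP[/asboolP vw /asboolP wv].
by apply: tower_type_inj; apply/seteqP.
Qed.

Lemma tower_le_trans : transitive tower_le.
Proof.
move=> w v u /asboolP vw /asboolP wu; apply/asboolP.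
exact: subset_trans vw wu.
Qed.

Lemma tower_le_total : total tower_le.
Proof.
move=> v w; apply/orP; case: (tower_gap (svalP w) (svalP v)) => [vw|wv].
  by left; apply/asboolP.
by right; apply/asboolP; exact: subset_trans (@F_ext _) wv.
Qed.

HB.instance Definition _ :=
  @Order.Le_isPOrder.Build (Order.Disp tt tt) tower_type tower_le
    tower_le_refl tower_le_anti tower_le_trans.
HB.instance Definition _ :=
  @Order.POrder_isTotal.Build (Order.Disp tt tt) tower_type tower_le_total.

(* The instance depends on the proof [F_ext], which unification cannot recover
   outside the section. *)
Definition tower_order : orderType (Order.Disp tt tt) := tower_type.

Local Open Scope order_scope.

Lemma tower_leP v w : v <= w <-> sval v `<=` sval w.
Proof. by split=> [/asboolP|vw] //; apply/asboolP. Qed.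

Lemma tower_ltP v w : v < w <-> sval v `<=` sval w /\ ~ (sval w `<=` sval v).
Proof.
by rewrite lt_leAnge; split=> [/andP[/tower_leP vw /negP wv]|[/tower_leP-> wv]];
  [split=> // /tower_leP|apply/negP => /tower_leP].
Qed.

Lemma tower_wf : well_founded (fun v w : tower_type => v < w).
Proof.
(* Accessibility is claimed for everything inside [V], so that induction on [tower V] applies: by
   the gap, a stage strictly below [F V] lies in [V], and one strictly below a supremum lies in some
   member. *)
suff accV V : tower V -> forall v, sval v `<=` V ->
    Acc (fun v w : tower_type => v < w) v.
  by move=> v; exact: (accV _ (svalP v)).
elim=> {V} [V tV IH|S tS IH] v vV; constructor=> w /tower_ltP[wv vw].
  case: (tower_gap tV (svalP w)) => [|Vw]; first exact: IH.
  by case: vw; exact: subset_trans vV Vw.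
case: (sup_cases S (tower_base (svalP w))) => [Sw|[U SU Uw]].
  by case: vw; exact: subset_trans vV Sw.
apply: (IH _ SU).
case: (tower_gap (tS _ SU) (svalP w)) => // Uw'.
by case: Uw; exact: subset_trans (@F_ext _) Uw'.
Qed.

Lemma tower_least : tower A.
Proof.
have := @tower_sup set0 (fun V (V0 : set0 V) => False_ind _ V0).
by rewrite bigcup_set0 setU0.
Qed.

Lemma iterate_tower w : iterate tower_wf F A w = sval w.
Proof.
elim/(well_founded_ind tower_wf): w => w IH.
case: (pselect (is_least w)) => [w0|wN0].
  rewrite iterate_least //; apply/seteqP; split; first exact: tower_base (svalP w).
  by have /tower_leP := w0 (exist _ A tower_least).
case: (pselect (exists u, is_successor w u)) => [[u wu]|wNS].
  rewrite (iterate_successor _ _ _ wu); case: wu => uw uP; rewrite IH //.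
  have /tower_ltP[_ wu] := uw.
  apply/seteqP; split; first by case: (tower_gap (svalP u) (svalP w)).
  (* The stage [F (sval u)] is strictly above [u]: otherwise [sval u] would be a fixed point, hence
     the largest stage, against [u < w]. So the successor [w] is below it. *)
  apply/(proj1 (tower_leP w (exist _ _ (tower_step (svalP u)))))/uP/tower_ltP.
  split=> [|/= Fu]; first exact: F_ext.
  have /tower_fixed_max Fmax : F (sval u) = sval u by apply/seteqP.
  exact/wu/Fmax/(svalP w)/(svalP u).
rewrite (iterate_limit _ _ _ (conj wN0 wNS)).
rewrite (@eq_bigcupr _ _ _ _ (fun u : tower_type => sval u)) //.
apply/seteqP; split=> [x [u /tower_ltP[uw _]]|]; first exact: uw.
pose S := [set sval u | u in [set u | u < w]].
have tS : tower (A `|` \bigcup_(V in S) V).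
  by apply: tower_sup => V [u _ <-]; exact: svalP.
case: (sup_cases S (tower_base (svalP w))) => [Sw|[_ [u uw <-]]]; last first.
  by have /tower_ltP[? _] := uw.
have [wS|wS] := pselect (sval w `<=` A `|` \bigcup_(V in S) V).
  (* Points of [A] must also come from a predecessor of [w]; the bottom stage is one, since [w] is
     not least. *)
  have Aw : (exist _ A tower_least : tower_type) < w.
    apply/tower_ltP; split=> [|wA]; first exact: tower_base (svalP w).
    apply: wN0 => u; apply/tower_leP/(subset_trans wA).
    exact: tower_base (svalP u).
  move=> x /wS[Ax|[_ [u uw <-] ux]]; last by exists u.
  by exists (exist _ A tower_least).
(* Otherwise the proper part [A `|` \bigcup S] of [w] is a predecessor of [w]. *)
case: wNS; exists (exist _ _ tS); split; first exact/tower_ltP.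
move=> v /tower_ltP[_ vS]; rewrite leNgt; apply/negP => vw; apply: vS.
by apply: sub_sup; exists v.
Qed.

(** [tower_sup] is impredicative: it applies to the family of all stages, whose union is thus a
    stage containing its own image. *)
Lemma exists_iterate_closed :
  exists w : tower_type, F (iterate tower_wf F A w) `<=` iterate tower_wf F A w.
Proof.
have tM : tower (A `|` \bigcup_(V in tower) V) by exact: tower_sup.
exists (exist _ _ tM); rewrite iterate_tower /=.
exact/sub_sup/tower_step.
Qed.

End Tower.

(** A bound uniform in the well-order, so that stages indexed by different orders never have to be
    compared. *)
Lemma iterate_sub o (W : orderType o)
    (W_wf : well_founded (fun u w : W => (u < w)%O))
    (X : Type) (F : set X -> set X) (A B : set X) :
  A `<=` B -> (forall V, V `<=` B -> F V `<=` B) ->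
  forall w, iterate W_wf F A w `<=` B.
Proof.
move=> AB FB; elim/(well_founded_ind W_wf) => w IH x.
rewrite iterateE => -[[_ /AB//]|[u [uw [_ Fx]]]|[_ [u [uw]]]].
  exact: FB (IH _ uw) _ Fx.
exact: IH.
Qed.

(** * [cl_star] as a least closed set *)

Section ClosureStar.
Variables (P : Type) (d : Order.disp_t) (T : orderType d) (s : semantics).
Variables (ab : hs_interval T) (phi : horn P).

Lemma cl_mono (V V' : set (literal P * hs_interval T)) :
  V `<=` V' -> cl s phi V `<=` cl s phi V'.
Proof.
move=> VV' [l i] [[[/VV'|[r [j [/VV' ? ?]]]]|[r [m [? ? Vm]]]]|[ls [? Vls]]].
- by move=> ?; do 3 left.
- by left; left; right; exists r, j.
- by left; right; exists r, m; split=> // j /Vm/VV'.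
- by right; exists ls; split=> // m /Vls/VV'.
Qed.

Lemma cl_star_sub (B : set (literal P * hs_interval T)) :
  V_init ab phi `<=` B -> cl s phi B `<=` B -> cl_star s ab phi `<=` B.
Proof.
move=> initB clB li [o [W [W_wf [w]]]]; apply: iterate_sub => // V VB.
exact: subset_trans (cl_mono VB) clB.
Qed.

(** The union over all well-orders is attained at a single stage: the closed stage of the tower
    contains [V_init], hence bounds all iterations. *)
Lemma cl_star_iterate : exists o (W : orderType o)
    (W_wf : well_founded (fun u w : W => (u < w)%O)) (w : W),
  let V := iterate W_wf (cl s phi) (V_init ab phi) w in
  [/\ V_init ab phi `<=` V, cl s phi V `<=` V & cl_star s ab phi = V].
Proof.
have cl_ext (V : set (literal P * hs_interval T)) : V `<=` cl s phi V.
  by move=> li Vli; do 3 left.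
have [w clw] := exists_iterate_closed (V_init ab phi) cl_ext.
have initw := tower_base cl_ext (svalP w); rewrite -(iterate_tower cl_ext) in initw.
exists _, (tower_order (V_init ab phi) cl_ext), (tower_wf cl_ext), w; split=> //.
apply/seteqP; split; first exact: cl_star_sub.
by move=> li wli; exists _, (tower_order (V_init ab phi) cl_ext), (tower_wf cl_ext), w.
Qed.

Lemma cl_star_init : V_init ab phi `<=` cl_star s ab phi.
Proof. by have [o [W [W_wf [w [initw _ ->]]]]] := cl_star_iterate. Qed.

Lemma cl_star_closed : cl s phi (cl_star s ab phi) `<=` cl_star s ab phi.
Proof. by have [o [W [W_wf [w [_ clw ->]]]]] := cl_star_iterate. Qed.

End ClosureStar.

(** * Horn formulas as collections of initial conditions and clauses *)

Section Horn.
Variables (P : Type) (phi : horn P).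

Lemma horn_trueP d (T : orderType d) s (M : model P T) i :
  horn_true s M i phi <->
  (forall l, initial_condition phi l -> lit_true s M i l) /\
  (forall ls l, has_clause phi ls l -> horn_true s M i (Clause ls l)).
Proof.
elim: phi => [m|ls m|phi1 [IH1 IH1'] phi2 [IH2 IH2']] /=.
- by split=> [? | [H _]]; [split=> // l -> | exact: H].
- by split=> [? | [_ H]]; [split=> // ls' l [-> ->] | exact: H].
split=> [[/IH1[i1 c1] /IH2[i2 c2]]|[Hi Hc]].
  by split=> [l [/i1|/i2]|ls l [/c1|/c2]].
split; [apply: IH1'|apply: IH2']; split=> *.
- by apply: Hi; left.
- by apply: Hc; left.
- by apply: Hi; right.
- by apply: Hc; right.
Qed.

Definition literal_of (l : literal P) : Prop :=
  initial_condition phi l \/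
  exists ls m, has_clause phi ls m /\ (l = m \/ List.In l ls).

Lemma literal_of_occurs l m :
  literal_of l -> occurs_in_literal m l -> occurs m phi.
Proof.
rewrite /literal_of => + ml.
elim: phi => [l'|ls l'|phi1 IH1 phi2 IH2] /=.
- by case=> [<-|[? [? [[]]]]].
- case=> [[]|[ls' [m' [[-> ->] [<-|lls]]]]]; first by right.
  by left; exists l.
- case=> [[?|?]|[ls [m' [[?|?] ?]]]]; [left; apply: IH1|right; apply: IH2|
    left; apply: IH1|right; apply: IH2]; by [left|right; exists ls, m'].
Qed.

Lemma literal_of_box_only l : horn_box phi -> literal_of l -> lit_box_only l.
Proof.
rewrite /literal_of.
elim: phi => [l'|ls l'|phi1 IH1 phi2 IH2] /=.
- by move=> ? [->|[? [? [[]]]]].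
- move=> /andP[bls bl'] [[]|[ls' [m' [[-> ->] [->//|]]]]].
  elim: ls bls {ls'} => //= a ls IH /andP[ba bls] [<-//|]; exact: IH.
- move=> /andP[b1 b2].
  case=> [[?|?]|[ls [m' [[?|?] ?]]]]; [apply: IH1|apply: IH2|
    apply: IH1|apply: IH2]; by [|left|right; exists ls, m'].
Qed.

End Horn.

(** * Soundness of the closure and truth in the canonical model *)

Section Canonical.
Variables (P : Type) (d : Order.disp_t) (T : orderType d) (s : semantics).
Variables (ab : hs_interval T) (phi : horn P).

Lemma cl_star_sound (M : model P T) : horn_true s M ab phi ->
  forall l i, cl_star s ab phi (l, i) -> lit_true s M i l.
Proof.
move=> /horn_trueP[Minit Mclause] l i.
apply: (@cl_star_sub _ _ _ _ _ _ [set li | lit_true s M li.2 li.1]) (l, i).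
  by case=> l' j [[/= /Minit Ml ->]|/= ->].
case=> l' j [[[//|[r [k [/= Mk kj]]]]|[r [m [/= -> _ Mm]]]]|[ls [lsl Mls]]].
- exact: Mk.
- exact: Mm.
- exact: Mclause lsl _ Mls.
Qed.

Hypothesis noBot : forall xy, ~ cl_star s ab phi (Bot, xy).

(** For a box, (cl2) turns truth into derivability and (cl1) the converse. The occurrence hypothesis
    is the side condition of (cl2), stated for all subliterals so that it survives the induction. *)
Lemma canonical_truth l : lit_box_only l ->
  (forall m, occurs_in_literal m l -> occurs m phi) ->
  forall i, lit_true s (canonical_model s ab phi) i l <->
            cl_star s ab phi (l, i).
Proof.
elim: l => [||p|//|r l IH] /= bl occ i.
- by split=> // _; apply: cl_star_init; right.
- by split=> // /noBot.
- by [].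
have {}IH := IH bl (fun m ml => occ m (or_intror ml)).
split=> [Kl|rl j ij].
  apply: cl_star_closed; left; right; exists r, l; split=> //.
    by apply: occ; left.
  by move=> j /Kl/IH.
by apply/IH/cl_star_closed; left; left; right; exists r, i.
Qed.

Lemma canonical_horn_true :
  horn_box phi -> horn_true s (canonical_model s ab phi) ab phi.
Proof.
move=> bphi.
have truth l i (lphi : literal_of phi l) := canonical_truth
  (literal_of_box_only bphi lphi) (fun m => literal_of_occurs lphi) i.
apply/horn_trueP; split=> [l il|ls l cl_lsl j Kls].
  by apply/truth; [left|apply: cl_star_init; left].
apply/truth; first by right; exists ls, l; split=> //; left.
apply: cl_star_closed; right; exists ls; split=> //= l' lsl'.
by apply/truth; [right; exists ls, l; split=> //; right|exact: Kls].
Qed.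

End Canonical.

Theorem theorem3p2 (d : Order.disp_t) (T : orderType d) (s : semantics)
    (ab : hs_interval T) (P : Type) (phi : horn P) (hphi : horn_box phi) :
  (satisfiable_at s ab phi <->
     forall xy : hs_interval T, ~ cl_star s ab phi (Bot, xy)) /\
  (forall M : model P T, horn_true s M ab phi ->
     horn_true s (canonical_model s ab phi) ab phi /\
     forall (xy : hs_interval T) (p : P),
       horn_true s (canonical_model s ab phi) xy (Init (PVar p)) ->
       horn_true s M xy (Init (PVar p))).
Proof.
have noBot M : horn_true s M ab phi ->
    forall xy : hs_interval T, ~ cl_star s ab phi (Bot, xy).
  by move=> Mphi xy /(cl_star_sound Mphi).
split; first split=> [[M /noBot//]|nB].
  by exists (canonical_model s ab phi); exact: canonical_horn_true.
move=> M Mphi; split; first exact: canonical_horn_true (noBot M Mphi) hphi.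
by move=> xy p /= /(cl_star_sound Mphi).
Qed.
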